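(* Consider the one-dimensional Maxwell--Lorentz finite difference scheme of Joseph et al. (coupling the variables $B$, $E$, $D$) in the anharmonic case $\nu>0$, with parameters $\epsilon_0,\mu_0,\epsilon_\infty,\omega_1,\delta t,\delta x>0$ and $\epsilon_s\ge\epsilon_\infty$, and let $c_\infty=1/\sqrt{\epsilon_0\epsilon_\infty\mu_0}$. The scheme is stable under the condition $$\delta t\le\frac{\delta x}{\sqrt2\,c_\infty}.$$
   Context: The scheme is, for $j,n$ integers, $$\tfrac1{\delta t}(B_{j+1/2}^{n+1/2}-B_{j+1/2}^{n-1/2})=-\tfrac1{\delta x}(E_{j+1}^n-E_j^n),\qquad \tfrac1{\delta t}(D_j^{n+1}-D_j^n)=-\tfrac1{\mu_0\delta x}(B_{j+1/2}^{n+1/2}-B_{j-1/2}^{n+1/2}),$$ $$\epsilon_0\epsilon_\infty\frac{E_j^{n+1}-2E_j^n+E_j^{n-1}}{\delta t^2}+\nu\epsilon_0\epsilon_\infty\frac{E_j^{n+1}-E_j^{n-1}}{2\delta t}+\epsilon_0\epsilon_s\omega_1^2\frac{E_j^{n+1}+E_j^{n-1}}2=\frac{D_j^{n+1}-2D_j^n+D_j^{n-1}}{\delta t^2}+\nu\frac{D_j^{n+1}-D_j^{n-1}}{2\delta t}+\omega_1^2\frac{D_j^{n+1}+D_j^{n-1}}2 .$$ Here $\nu$ is the damping coefficient and $\omega_1$ the resonant frequency. Put $\lambda=c_\infty\delta t/\delta x$, $\delta=\nu\delta t/2$, $\omega=\omega_1^2\delta t^2/2$, $\epsilon_s'=\epsilon_s/\epsilon_\infty$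 and, for $\xi\in\mathbb R$, $\sigma=\lambda(e^{i\xi}-1)$, $q=|\sigma|^2=4\lambda^2\sin^2(\xi/2)$; a star denotes complex conjugation. For plane waves $U_j^n=U^n e^{i\xi j}$ in the variable $U_j^n=(c_\infty B_{j+1/2}^{n-1/2},E_j^n,E_j^{n-1},D_j^n/(\epsilon_0\epsilon_\infty))^t$ (the quantity $D_j^{n-1}$ being eliminated through the discrete Amp\`ere equation between times $n-1$ and $n$) the scheme reads $U^{n+1}=G(\xi)U^n$ with amplification matrix $$G(\xi)=\begin{pmatrix}1&-\sigma&0&0\\ \frac{2\delta\sigma^*}{1+\delta+\omega\epsilon_s'}&\frac{2-q(1+\delta+\omega)}{1+\delta+\omega\epsilon_s'}&-\frac{1-\delta+\omega\epsilon_s'}{1+\delta+\omega\epsilon_s'}&\frac{2\omega}{1+\delta+\omega\epsilon_s'}\\ 0&1&0&0\\ \sigma^*&-q&0&1\end{pmatrix}.$$ Stability (in the sense of von Neumann) means: for every $\xi\in\mathbb R$, the sequence of powers $(G(\xi)^n)_{n\ge0}$ is bounded. *)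

(* Defs.v *)
From HB Require Import structures.
From mathcomp Require Import all_boot all_order all_algebra.
From mathcomp Require Import complex.
From mathcomp Require Import all_classical all_reals all_analysis.
From mathcomp Require Import ring lra.

Set Implicit Arguments.
Unset Strict Implicit.
Unset Printing Implicit Defensive.

Import Order.TTheory GRing.Theory Num.Theory.
Import numFieldNormedType.Exports.

Local Open Scope complex_scope.
Local Open Scope ring_scope.

Record ml_params (R : realType) := MLParams {
  eps0 : R;   (* vacuum permittivity *)
  mu0 : R;    (* vacuum permeability *)
  epsinf : R; (* relative permittivity at infinite frequency *)
  epss : R;   (* relative static permittivity *)
  nu : R;     (* damping coefficient *)
  omega1 : R; (* resonant frequency *)
  dt : R;     (* time step *)
  dx : R      (* space step *)
}.

Definition cinf (R : realType) (p : ml_params R) : R :=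
  1 / Num.sqrt (eps0 p * epsinf p * mu0 p).

Definition lambda (R : realType) (p : ml_params R) : R := cinf p * dt p / dx p.
Definition delta (R : realType) (p : ml_params R) : R := nu p * dt p / 2.
Definition omega (R : realType) (p : ml_params R) : R :=
  omega1 p ^+ 2 * dt p ^+ 2 / 2.
Definition epss' (R : realType) (p : ml_params R) : R := epss p / epsinf p.

(* e^{it} *)
Definition expi (R : realType) (t : R) : R[i] := cos t +i* sin t.

(* The magnetic induction lives on the staggered grid:
   [B j n] stands for B_{j+1/2}^{n-1/2}, while [E j n] and [D j n]
   stand for E_j^n and D_j^n. *)
Definition ml_scheme (R : realType) (p : ml_params R)
    (B E D : int -> int -> R[i]) : Prop :=
  forall j n : int,
  [/\ (dt p)^-1%:C * (B j (n + 1) - B j n)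
        = - ((dx p)^-1%:C * (E (j + 1) n - E j n)),
      (dt p)^-1%:C * (D j (n + 1) - D j n)
        = - ((mu0 p * dx p)^-1%:C * (B j (n + 1) - B (j - 1) (n + 1)))
    & (eps0 p * epsinf p)%:C
          * ((E j (n + 1) - 2 * E j n + E j (n - 1)) / (dt p ^+ 2)%:C)
        + (nu p * eps0 p * epsinf p)%:C
          * ((E j (n + 1) - E j (n - 1)) / (2 * dt p)%:C)
        + (eps0 p * epss p * omega1 p ^+ 2)%:C
          * ((E j (n + 1) + E j (n - 1)) / 2)
      = (D j (n + 1) - 2 * D j n + D j (n - 1)) / (dt p ^+ 2)%:C
        + (nu p)%:C * ((D j (n + 1) - D j (n - 1)) / (2 * dt p)%:C)
        + (omega1 p ^+ 2)%:C * ((D j (n + 1) + D j (n - 1)) / 2)].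

Definition sigma (R : realType) (p : ml_params R) (xi : R) : R[i] :=
  (lambda p)%:C * (expi xi - 1).

Definition qsym (R : realType) (p : ml_params R) (xi : R) : R[i] :=
  `|sigma p xi| ^+ 2.

Definition amplification (R : realType) (p : ml_params R) (xi : R) : 'M[R[i]]_4 :=
  let s := sigma p xi in
  let q := qsym p xi in
  let d := (delta p)%:C in
  let w := (omega p)%:C in
  let e := (epss' p)%:C in
  let den := 1 + d + w * e in
  \matrix_(i < 4, j < 4)
    nth 0 (nth [::]
      [:: [:: 1;              - s;                         0;                         0];
          [:: 2 * d * s^* / den; (2 - q * (1 + d + w)) / den;
              - ((1 - d + w * e) / den);                      2 * w / den];
          [:: 0;              1;                           0;                         0];
          [:: s^*;            - q;                         0;                         1]] i) j.

(* For each xi, boundedness is with respect to the (entrywise maximum) norm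
   of 'M[R[i]]_4. *)
Definition von_neumann_stable (R : realType) (G : R -> 'M[R[i]]_4) : Prop :=
  forall xi : R, bounded_fun (fun n : nat => G xi ^+ n).

(* The vector (c_inf B^{n-1/2}, E^n, E^{n-1}, D^n / (eps0 eps_inf))^t *)
Definition ml_state (R : realType) (p : ml_params R) (B E D : int -> R[i])
    (n : int) : 'cV[R[i]]_4 :=
  \col_(i < 4) nth 0 [:: (cinf p)%:C * B n; E n; E (n - 1);
                         D n / (eps0 p * epsinf p)%:C] i.

Lemma expiD (R : realType) (s t : R) : expi (s + t) = expi s * expi t.
Proof.
by rewrite /expi cosD sinD; apply/eqP; rewrite eq_complex /= eqxx /= addrC.
Qed.

Lemma expi_conj (R : realType) (t : R) : expi t * (expi t)^* = 1.
Proof.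
apply/eqP; rewrite eq_complex /=; apply/andP; split; apply/eqP.
  by rewrite mulrN opprK -!expr2 cos2Dsin2.
by rewrite mulrN [sin t * _]mulrC addNr.
Qed.

Lemma expi_neq0 (R : realType) (t : R) : expi t != 0.
Proof.
by apply/eqP => t0; have /eqP := expi_conj t; rewrite t0 mul0r eq_sym oner_eq0.
Qed.

(* Elimination over a field: [b], [b1] are B^{n-1/2}, B^{n+1/2}, and
   [e1, e, em], [d1, d, dm] are the values at times n+1, n, n-1;
   [a] is e^{i xi} and [a'] its inverse. *)
Lemma ml_elim (F : fieldType) (e0 mu ei es v w t x c a a' : F)
    (b b1 e1 e em d1 d dm : F) :
  2 != 0 :> F -> e0 != 0 -> mu != 0 -> ei != 0 -> t != 0 -> x != 0 ->
  c ^+ 2 * (e0 * ei * mu) = 1 -> a * a' = 1 ->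
  let l := c * t / x in
  let s := l * (a - 1) in
  let s' := l * (a' - 1) in
  let q := s * s' in
  let de := v * t / 2 in
  let om := w ^+ 2 * t ^+ 2 / 2 in
  let es' := es / ei in
  let den := 1 + de + om * es' in
  den != 0 ->
  t^-1 * (d - dm) = - ((mu * x)^-1 * (b - a' * b)) ->
  [/\ t^-1 * (b1 - b) = - (x^-1 * (a * e - e)),
      t^-1 * (d1 - d) = - ((mu * x)^-1 * (b1 - a' * b1))
    & (e0 * ei) * ((e1 - 2 * e + em) / t ^+ 2)
      + (v * e0 * ei) * ((e1 - em) / (2 * t))
      + (e0 * es * w ^+ 2) * ((e1 + em) / 2)
      = (d1 - 2 * d + dm) / t ^+ 2 + v * ((d1 - dm) / (2 * t))
        + w ^+ 2 * ((d1 + dm) / 2)] <->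
  [/\ c * b1 = c * b - s * e,
      e1 = 2 * de * s' / den * (c * b) + (2 - q * (1 + de + om)) / den * e
           - (1 - de + om * es') / den * em + 2 * om / den * (d / (e0 * ei))
    & d1 / (e0 * ei) = s' * (c * b) - q * e + d / (e0 * ei)].
Proof.
move=> n2 ne0 nmu nei nt nx hc haa l s s' q de om es' den nden hdm.
have nc : c != 0.
  by apply/eqP => c0; move: hc; rewrite c0 expr0n mul0r => /eqP; rewrite eq_sym oner_eq0.
have dmE : dm = d - (e0 * ei) * s' * (c * b).
  have -> : dm = d - t * (t^-1 * (d - dm)) by field.
  rewrite hdm /s' /l.
  have -> : e0 * ei * (c * t / x * (a' - 1)) * (c * b)
     = (c ^+ 2 * (e0 * ei * mu)) * (t / (mu * x) * (a' - 1) * b) by (field; rewrite nx nmu).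
  by rewrite hc; (field; rewrite nx nmu).
have d1E : t^-1 * (d1 - d) = - ((mu * x)^-1 * (b1 - a' * b1)) <->
    d1 = d + (e0 * ei) * s' * (c * b1).
  have X : e0 * ei * s' * (c * b1)
     = t * (- ((mu * x)^-1 * (b1 - a' * b1))).
    rewrite /s' /l.
    have -> : e0 * ei * (c * t / x * (a' - 1)) * (c * b1)
     = (c ^+ 2 * (e0 * ei * mu)) * (t / (mu * x) * (a' - 1) * b1) by (field; rewrite nx nmu).
    by rewrite hc; (field; rewrite nx nmu).
  rewrite X; split => [<-|->]; field; rewrite ?nx ?nmu ?nt //.
have b1E : t^-1 * (b1 - b) = - (x^-1 * (a * e - e)) <-> c * b1 = c * b - s * e.
  split => h.
    have -> : b1 = b + t * (t^-1 * (b1 - b)) by field.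
    by rewrite h /s /l; field.
  have -> : b1 = c^-1 * (c * b1) by field.
  by rewrite h /s /l; (field; rewrite nx nt nc).
have nee : e0 * ei != 0 by rewrite mulf_neq0.
have key : c * b1 = c * b - s * e ->
    d1 = d + (e0 * ei) * s' * (c * b1) ->
  ((e0 * ei) * ((e1 - 2 * e + em) / t ^+ 2)
      + (v * e0 * ei) * ((e1 - em) / (2 * t))
      + (e0 * es * w ^+ 2) * ((e1 + em) / 2)
      - ((d1 - 2 * d + dm) / t ^+ 2 + v * ((d1 - dm) / (2 * t))
        + w ^+ 2 * ((d1 + dm) / 2))) =
   (e0 * ei * den / t ^+ 2) * (e1 -
   (2 * de * s' / den * (c * b) + (2 - q * (1 + de + om)) / den * e
           - (1 - de + om * es') / den * em + 2 * om / den * (d / (e0 * ei)))).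
  move=> h1 h2; rewrite h2 dmE h1.
  set P := c * b; set E1 := (2 * de * s' / den * P); 
  have -> : e0 * ei * den / t ^+ 2 * (e1 - (E1 + (2 - q * (1 + de + om)) / den * e
      - (1 - de + om * es') / den * em + 2 * om / den * (d / (e0 * ei)))) =
    e0 * ei / t ^+ 2 * (den * e1 - (2 * de * s' * P + (2 - q * (1 + de + om)) * e
      - (1 - de + om * es') * em + 2 * om * (d / (e0 * ei)))).
    by rewrite /E1; (field; rewrite nt nden ne0 nei).
  rewrite /den /q /de /om /es'.
  by (field; rewrite nei ne0 n2 nt).
split.
  case=> /b1E h1 /d1E h2 h3; split => //.
    have := key h1 h2; rewrite h3 subrr => /esym /eqP.
    rewrite mulf_eq0 mulf_eq0 (negbTE (mulf_neq0 nee nden)) invr_eq0 expf_eq0 (negbTE nt) /=.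
    by rewrite subr_eq0 => /eqP.
  by rewrite h2 h1 /q; (field; rewrite ne0 nei).
case=> h1 h2 h3.
have h4 : d1 = d + (e0 * ei) * s' * (c * b1).
  have -> : d1 = e0 * ei * (d1 / (e0 * ei)) by (field; rewrite ne0 nei).
  by rewrite h3 h1 /q; (field; rewrite ne0 nei).
split; [exact/b1E|exact/d1E|].
apply/eqP; rewrite -subr_eq0 key // {1}h2 subrr mulr0 //.
Qed.

Lemma ml_ampere (F : fieldType) (e0 mu ei t x c a a' b b1 e d1 d : F) :
  e0 != 0 -> mu != 0 -> ei != 0 -> t != 0 -> x != 0 ->
  c ^+ 2 * (e0 * ei * mu) = 1 ->
  let l := c * t / x in
  let s := l * (a - 1) in
  let s' := l * (a' - 1) in
  c * b1 = c * b - s * e ->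
  d1 / (e0 * ei) = s' * (c * b) - s * s' * e + d / (e0 * ei) ->
  t^-1 * (d1 - d) = - ((mu * x)^-1 * (b1 - a' * b1)).
Proof.
move=> ne0 nmu nei nt nx hc l s s' h1 h2.
have nee : e0 * ei != 0 by rewrite mulf_neq0.
have -> : d1 = d + (e0 * ei) * s' * (c * b1).
  have -> : d1 = e0 * ei * (d1 / (e0 * ei)) by (field; rewrite ne0 nei).
  by rewrite h2 h1; (field; rewrite ne0 nei).
have -> : e0 * ei * s' * (c * b1)
     = (c ^+ 2 * (e0 * ei * mu)) * (t / (mu * x) * (a' - 1) * b1).
  by rewrite /s' /l; (field; rewrite nx nmu).
by rewrite hc; (field; rewrite nx nmu nt).
Qed.

(* On plane waves the scheme reads U^{n+1} = G(xi) U^n. *)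
Lemma ml_scheme_plane_wave (R : realType) (p : ml_params R) (xi : R)
    (B E D : int -> R[i]) :
  0 < eps0 p -> 0 < mu0 p -> 0 < epsinf p -> 0 <= epss p -> 0 <= nu p ->
  0 < dt p -> 0 < dx p ->
  let wave (U : int -> R[i]) (j n : int) := U n * expi (xi * j%:~R) in
  ml_scheme p (wave B) (wave E) (wave D) <->
  forall n : int,
    ml_state p B E D (n + 1) = amplification p xi *m ml_state p B E D n.
Proof.
move=> e0 mu ei es v t x wave.
set s := sigma p xi.
have nz (y : R) : 0 < y -> y%:C != 0 by move=> y0; rewrite fmorph_eq0 gt_eqF.
have hc : (cinf p)%:C ^+ 2 * ((eps0 p)%:C * (epsinf p)%:C * (mu0 p)%:C) = 1.
  rewrite -!rmorphM -rmorphXn -rmorphM /= -(rmorph1 (@real_complex_def _ (Phant R))).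
  congr (_%:C).
  have P : 0 < eps0 p * epsinf p * mu0 p by rewrite !mulr_gt0.
  by rewrite /cinf div1r exprVn sqr_sqrtr ?(ltW P)// mulVf// gt_eqF.
have den0 : 1 + (delta p)%:C + (omega p)%:C * (epss' p)%:C != 0 :> R[i].
  rewrite -!rmorphM -(rmorph1 (@real_complex_def _ (Phant R))) -!rmorphD /=.
  apply: nz; rewrite -addrA ltr_pwDl//.
  have := ltW t; have := ltW ei => ei0 t0.
  rewrite /delta /omega /epss'; apply: addr_ge0.
    by rewrite !mulr_ge0// invr_ge0.
  apply: mulr_ge0; last by rewrite divr_ge0.
  by rewrite divr_ge0// mulr_ge0 ?sqr_ge0.
have n2 : 2 != 0 :> R[i] by rewrite pnatr_eq0.
have CM (y z : R) : (y * z)%:C = y%:C * z%:C := rmorphM _ y z.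
have CV (y : R) : (y^-1)%:C = (y%:C)^-1 := fmorphV _ y.
have CX (y : R) n : (y ^+ n)%:C = y%:C ^+ n := rmorphXn _ n y.
have C2 : (2 : R)%:C = 2 := rmorph_nat _ 2.
set a := expi xi; set a' := a^*.
have aa : a * a' = 1 := expi_conj xi.
have conjR (y : R) : (y%:C)^* = y%:C :> R[i].
  by apply/eqP; rewrite eq_complex /= oppr0 !eqxx.
have sE : s^* = (lambda p)%:C * (a' - 1).
  by rewrite /s /sigma rmorphM rmorphB rmorph1; congr (_ * _); exact: conjR.
have qE : qsym p xi = s * s^* by rewrite /qsym normCK.
pose elim := @ml_elim R[i] (eps0 p)%:C (mu0 p)%:C (epsinf p)%:C (epss p)%:C
  (nu p)%:C (omega1 p)%:C (dt p)%:C (dx p)%:C (cinf p)%:C a a'.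
have lE : (cinf p)%:C * (dt p)%:C / (dx p)%:C = (lambda p)%:C.
  by rewrite /lambda (CM (_ * _)) (CM (cinf p)) CV.
have dE : (nu p)%:C * (dt p)%:C / 2 = (delta p)%:C.
  by rewrite /delta (CM (_ * _)) (CM (nu p)) CV C2.
have wE : (omega1 p)%:C ^+ 2 * (dt p)%:C ^+ 2 / 2 = (omega p)%:C.
  by rewrite /omega (CM (_ * _)) (CM (_ ^+ 2)) !CX CV C2.
have eE : (epss p)%:C / (epsinf p)%:C = (epss' p)%:C.
  by rewrite /epss' (CM (epss p)) CV.
have ampere b b1 e d1 d := @ml_ampere R[i] _ _ _ _ _ _ a a' b b1 e d1 d
  (nz _ e0) (nz _ mu) (nz _ ei) (nz _ t) (nz _ x) hc.
rewrite /= lE -sE -/s in ampere.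
have {}elim b b1 e1 e em d1 d dm := elim b b1 e1 e em d1 d dm n2 (nz _ e0)
  (nz _ mu) (nz _ ei) (nz _ t) (nz _ x) hc aa.
rewrite /= lE dE wE eE -sE -/s in elim.
have {}elim b b1 e1 e em d1 d dm := elim b b1 e1 e em d1 d dm den0.
(* the scheme, with the common factor e^{i xi j} divided out *)
pose sch n := [/\ (dt p)%:C^-1 * (B (n + 1) - B n) = - ((dx p)%:C^-1 * (a * E n - E n)),
  (dt p)%:C^-1 * (D (n + 1) - D n)
    = - (((mu0 p)%:C * (dx p)%:C)^-1 * (B (n + 1) - a' * B (n + 1)))
  & ((eps0 p)%:C * (epsinf p)%:C) * ((E (n + 1) - 2 * E n + E (n - 1)) / (dt p)%:C ^+ 2)
    + ((nu p)%:C * (eps0 p)%:C * (epsinf p)%:C)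
      * ((E (n + 1) - E (n - 1)) / (2 * (dt p)%:C))
    + ((eps0 p)%:C * (epss p)%:C * (omega1 p)%:C ^+ 2) * ((E (n + 1) + E (n - 1)) / 2)
    = (D (n + 1) - 2 * D n + D (n - 1)) / (dt p)%:C ^+ 2
    + (nu p)%:C * ((D (n + 1) - D (n - 1)) / (2 * (dt p)%:C))
    + (omega1 p)%:C ^+ 2 * ((D (n + 1) + D (n - 1)) / 2)].
have schE : ml_scheme p (wave B) (wave E) (wave D) <-> forall n, sch n.
  have wS U j n : wave U (j + 1) n = expi (xi * j%:~R) * (a * U n).
    by rewrite /wave intrD mulrDr mulr1 expiD -/a; ring.
  have w0 U j n : wave U j n = expi (xi * j%:~R) * U n by rewrite /wave mulrC.
  have wP U j n : wave U (j - 1) n = expi (xi * j%:~R) * (a' * U n).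
    have : a * wave U (j - 1) n = a * (expi (xi * j%:~R) * (a' * U n)).
      rewrite w0 mulrCA -[_ * (a * _)]wS subrK w0.
      have -> : a * (expi (xi * j%:~R) * (a' * U n))
         = (a * a') * (expi (xi * j%:~R) * U n) by ring.
      by rewrite aa mul1r.
    exact/mulfI/expi_neq0.
  have divw j n : [/\ (dt p)^-1%:C * (wave B j (n + 1) - wave B j n)
        = - ((dx p)^-1%:C * (wave E (j + 1) n - wave E j n)),
      (dt p)^-1%:C * (wave D j (n + 1) - wave D j n)
        = - ((mu0 p * dx p)^-1%:C * (wave B j (n + 1) - wave B (j - 1) (n + 1)))
    & (eps0 p * epsinf p)%:C
          * ((wave E j (n + 1) - 2 * wave E j n + wave E j (n - 1)) / (dt p ^+ 2)%:C)
        + (nu p * eps0 p * epsinf p)%:C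
          * ((wave E j (n + 1) - wave E j (n - 1)) / (2 * dt p)%:C)
        + (eps0 p * epss p * omega1 p ^+ 2)%:C
          * ((wave E j (n + 1) + wave E j (n - 1)) / 2)
      = (wave D j (n + 1) - 2 * wave D j n + wave D j (n - 1)) / (dt p ^+ 2)%:C
        + (nu p)%:C * ((wave D j (n + 1) - wave D j (n - 1)) / (2 * dt p)%:C)
        + (omega1 p ^+ 2)%:C * ((wave D j (n + 1) + wave D j (n - 1)) / 2)] <-> sch n.
    have zE := expi_neq0 (xi * j%:~R).
    rewrite !wS !wP !w0 /sch !(CX, CV, C2, CM).
    set z := expi (xi * j%:~R).
    have zeq (y1 y2 y1' y2' : R[i]) :
        y1 = z * y1' -> y2 = z * y2' -> (y1 = y2 <-> y1' = y2').
      by move=> -> ->; split=> [/(mulfI zE)//|->].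
    have and3_iff (P Q S P' Q' S' : Prop) : (P <-> P') -> (Q <-> Q') ->
        (S <-> S') -> ([/\ P, Q & S] <-> [/\ P', Q' & S']).
      by case=> ? ? [? ?] [? ?]; split=> -[? ? ?]; split; auto.
    by apply: and3_iff; apply: zeq; ring.
  by split=> h; [move=> n; apply/(divw 0)/h|move=> j n; apply/divw/h].
rewrite schE.
pose row n := [/\ (cinf p)%:C * B (n + 1) = (cinf p)%:C * B n - s * E n,
  E (n + 1) = 2 * (delta p)%:C * s^* / (1 + (delta p)%:C + (omega p)%:C * (epss' p)%:C)
     * ((cinf p)%:C * B n)
    + (2 - s * s^* * (1 + (delta p)%:C + (omega p)%:C))
      / (1 + (delta p)%:C + (omega p)%:C * (epss' p)%:C) * E n
    - (1 - (delta p)%:C + (omega p)%:C * (epss' p)%:C)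
      / (1 + (delta p)%:C + (omega p)%:C * (epss' p)%:C) * E (n - 1)
    + 2 * (omega p)%:C / (1 + (delta p)%:C + (omega p)%:C * (epss' p)%:C)
      * (D n / ((eps0 p)%:C * (epsinf p)%:C))
  & D (n + 1) / ((eps0 p)%:C * (epsinf p)%:C)
    = s^* * ((cinf p)%:C * B n) - s * s^* * E n + D n / ((eps0 p)%:C * (epsinf p)%:C)].
have rowE n : ml_state p B E D (n + 1) = amplification p xi *m ml_state p B E D n
    <-> row n.
  have rhs : amplification p xi *m ml_state p B E D n = \col_(i < 4) nth 0
    [:: (cinf p)%:C * B n - s * E n;
      2 * (delta p)%:C * s^* / (1 + (delta p)%:C + (omega p)%:C * (epss' p)%:C)
     * ((cinf p)%:C * B n)
    + (2 - s * s^* * (1 + (delta p)%:C + (omega p)%:C))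
      / (1 + (delta p)%:C + (omega p)%:C * (epss' p)%:C) * E n
    - (1 - (delta p)%:C + (omega p)%:C * (epss' p)%:C)
      / (1 + (delta p)%:C + (omega p)%:C * (epss' p)%:C) * E (n - 1)
    + 2 * (omega p)%:C / (1 + (delta p)%:C + (omega p)%:C * (epss' p)%:C)
      * (D n / ((eps0 p)%:C * (epsinf p)%:C));
      E n;
      s^* * ((cinf p)%:C * B n) - s * s^* * E n + D n / ((eps0 p)%:C * (epsinf p)%:C)] i.
    apply/colP => i; rewrite !mxE !big_ord_recl big_ord0 !mxE /= (CM (eps0 p)) -/s qE.
    by case: i => -[|[|[|[|//]]]] lti /=; ring.
  rewrite rhs; split.
    move/colP => h; split.
    - by have := h (@Ordinal 4 0 isT); rewrite !mxE.
    - by have := h (@Ordinal 4 1 isT); rewrite !mxE.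
    - by have := h (@Ordinal 4 3 isT); rewrite !mxE /= (CM (eps0 p)).
  case=> h1 h2 h3; apply/colP => i; rewrite !mxE.
  by case: i => -[|[|[|[|//]]]] lti /=; rewrite ?addrK ?(CM (eps0 p)).
split=> h n.
- apply/rowE; apply/elim; last exact: h.
  by have [_ + _] := h (n - 1); rewrite subrK.
- apply/elim; last exact/rowE/h.
  have /rowE [h1 h2 h3] := h (n - 1); rewrite subrK in h1 h2 h3.
  exact: ampere h1 h3.
Qed.

(* Main.v *)
Require Import Defs.
From mathcomp Require Import all_boot all_order all_algebra.
From mathcomp Require Import complex.
From mathcomp Require Import all_classical all_reals all_analysis.
From mathcomp Require Import ring lra.
Import Order.TTheory GRing.Theory Num.Theory.
Local Open Scope complex_scope.
Local Open Scope ring_scope.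

(** Divide [D] by [eps0 eps_inf] and write [P = D - E], [q = |sigma|^2] (at most
    [2] under the CFL condition) and
    [k = omega (eps_s' - 1) >= 0].  Eliminating [B], the plane waves satisfy
      D^{n+1} - 2 D^n + D^{n-1} = - q E^n,
      P^{n+1} - 2 P^n + P^{n-1} + delta (P^{n+1} - P^{n-1})
        + omega (P^{n+1} + P^{n-1}) = k (E^{n+1} + E^{n-1}).
    Multiplying the second equation by [P^{n+1} - P^{n-1}] and summing by parts
    in time shows that the energy
      k (2 |D^n - D^{n-1} + q (E^{n-1} - E^n) / 2|^2
         + q (1 - q / 2) (|E^n|^2 + |E^{n-1}|^2))
        + q (|P^n - P^{n-1}|^2 + omega (|P^n|^2 + |P^{n-1}|^2))
    decreases by [q delta |P^{n+1} - P^{n-1}|^2] at each step.  It is definite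
    when [k > 0] and [0 < q < 2].  When [k = 0] or [q = 2] it degenerates, but
    then the equation of [P] decouples into a strictly damped oscillator, and
    [E] is a leapfrog oscillator forced by [P], without resonance.  When
    [q = 0], [B] and [D] are constant and [E - D / eps_s'] is a damped
    oscillator. *)

(** * Bounded sequences and the energy criterion *)

Definition bounded_seq {K : numDomainType} (u : nat -> K) : Prop :=
  exists M, forall n, `|u n| <= M.

Lemma bounded_seqD {K : numDomainType} {u v : nat -> K} :
  bounded_seq u -> bounded_seq v -> bounded_seq (fun n => u n + v n).
Proof.
move=> [M uM] [N vN]; exists (M + N) => n.
exact: le_trans (ler_normD _ _) (lerD _ _).
Qed.

Lemma bounded_seqZ {K : numDomainType} (a : K) {u : nat -> K} :
  bounded_seq u -> bounded_seq (fun n => a * u n).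
Proof.
by move=> [M uM]; exists (`|a| * M) => n; rewrite normrM ler_wpM2l.
Qed.

Lemma bounded_seqS {K : numDomainType} {u : nat -> K} :
  bounded_seq u -> bounded_seq (fun n => u n.+1).
Proof. by move=> [M uM]; exists M. Qed.

Lemma bounded_seq_ext {K : numDomainType} {u v : nat -> K} :
  u =1 v -> bounded_seq u -> bounded_seq v.
Proof. by move=> uv [M uM]; exists M => n; rewrite -uv. Qed.

Lemma bounded_seqB {K : numDomainType} {u v : nat -> K} :
  bounded_seq u -> bounded_seq v -> bounded_seq (fun n => u n - v n).
Proof.
move=> bu /(bounded_seqZ (-1)) /(bounded_seqD bu).
by apply: bounded_seq_ext => n; rewrite mulN1r.
Qed.

Lemma bounded_seq_cst {K : numDomainType} (a : K) : bounded_seq (fun=> a).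
Proof. by exists `|a|. Qed.

(** The inequality [y <= 1 + y ^+ 2] replaces a square root, so any real field will do. *)
Lemma bounded_seq_energy {R : realFieldType} (c : R) (W u : nat -> R) :
  0 < c -> (forall n, W n.+1 <= W n) -> (forall n, c * u n ^+ 2 <= W n) ->
  bounded_seq u.
Proof.
move=> c0 Wdec uW; exists (1 + W 0%N / c) => n.
have W0 k : W k <= W 0%N by elim: k => // k; exact: le_trans.
have : u n ^+ 2 <= W 0%N / c.
  by rewrite ler_pdivlMr// mulrC (le_trans (uW n)).
rewrite -(real_normK (num_real (u n))).
set y := `|u n|; set z := W 0%N / c => yz.
have := sqr_ge0 (y - 1); nra.
Qed.

(** * Energy estimates for real recurrences *)

Section real_recurrences.
Context {R : realFieldType}.

(** Multiplying the equation by [P n.+2 - P n] makes the inertia and stiffness terms telescope and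
    leaves a dissipation of the sign of [d]. The inertia [m] is free because the degenerate cases
    below need both [1] and [1 + k]. *)
Lemma damped_bounded (m d w : R) (P : nat -> R) :
  0 <= m -> 0 <= d -> 0 < w ->
  (forall n, m * (P n.+2 - 2 * P n.+1 + P n) + d * (P n.+2 - P n)
             + w * (P n.+2 + P n) = 0) ->
  bounded_seq P.
Proof.
move=> m0 d0 w0 recP.
apply: (@bounded_seq_energy _ w (fun n => m * (P n.+1 - P n) ^+ 2
   + w * (P n.+1 ^+ 2 + P n ^+ 2))) => // n.
  rewrite -subr_ge0.
  set X := (X in 0 <= X).
  have -> : X = d * (P n.+2 - P n) ^+ 2
    - (P n.+2 - P n) * (m * (P n.+2 - 2 * P n.+1 + P n) + d * (P n.+2 - P n)
             + w * (P n.+2 + P n)) by rewrite /X; ring.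
  by rewrite recP mulr0 subr0 mulr_ge0// sqr_ge0.
rewrite -subr_ge0 mulrDr addrA addrK.
by rewrite addr_ge0// mulr_ge0 ?sqr_ge0// ltW.
Qed.

(** The invariant is [X n.+1 ^+ 2 - (2 - q) X n.+1 X n + X n ^+ 2] with the square completed; it is
    definite exactly for [0 < q < 4]. *)
Lemma leapfrog_bounded (q : R) (X : nat -> R) :
  0 < q -> q < 4 -> (forall n, X n.+2 - (2 - q) * X n.+1 + X n = 0) ->
  bounded_seq X.
Proof.
move=> q0 q4 recX.
apply: (@bounded_seq_energy _ (q * (1 - q / 4))
  (fun n => (X n.+1 - (1 - q / 2) * X n) ^+ 2 + q * (1 - q / 4) * X n ^+ 2)).
- by rewrite mulr_gt0//; lra.
- move=> n; rewrite -subr_ge0; set Y := (Y in 0 <= Y).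
  have -> : Y = - (X n.+2 - X n) * (X n.+2 - (2 - q) * X n.+1 + X n).
    by rewrite /Y; field.
  by rewrite recX mulr0.
- by move=> n; rewrite lerDr sqr_ge0.
Qed.

(* With [p(S)] the damped operator annihilating [P], [p(S) E] solves the
   homogeneous leapfrog recurrence; modulo the latter and up to bounded terms,
   [p(S)] is a first-order operator [g S + h], which is inverted using that
   the quadratic form [g^2 + (2 - q) g h + h^2] is definite. *)
Lemma forced_leapfrog_bounded (q m d w : R) (E P : nat -> R) :
  0 < q -> q < 4 -> 0 <= m -> 0 < d -> 0 < w ->
  (forall n, m * (P n.+2 - 2 * P n.+1 + P n) + d * (P n.+2 - P n)
             + w * (P n.+2 + P n) = 0) ->
  (forall n, E n.+2 - (2 - q) * E n.+1 + E n = - (P n.+2 - 2 * P n.+1 + P n)) ->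
  bounded_seq E.
Proof.
move=> q0 q4 m0 d0 w0 recP recE.
have bP : bounded_seq P := damped_bounded _ _ _ _ m0 (ltW d0) w0 recP.
pose f n := P n.+2 - 2 * P n.+1 + P n.
have bf : bounded_seq f.
  exact: bounded_seqD (bounded_seqB (bounded_seqS (bounded_seqS bP))
    (bounded_seqZ 2 (bounded_seqS bP))) bP.
pose X n := m * (E n.+2 - 2 * E n.+1 + E n) + d * (E n.+2 - E n)
             + w * (E n.+2 + E n).
have bX : bounded_seq X.
  apply: (leapfrog_bounded q) => // n.
  (* The operator [p(S)] commutes with the leapfrog one, so the forcing becomes minus the second
     difference of [p(S) P], which vanishes. *)
  have -> : X n.+2 - (2 - q) * X n.+1 + X n =
      m * ((E n.+4 - (2 - q) * E n.+3 + E n.+2)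
           - 2 * (E n.+3 - (2 - q) * E n.+2 + E n.+1)
           + (E n.+2 - (2 - q) * E n.+1 + E n))
      + d * ((E n.+4 - (2 - q) * E n.+3 + E n.+2)
           - (E n.+2 - (2 - q) * E n.+1 + E n))
      + w * ((E n.+4 - (2 - q) * E n.+3 + E n.+2)
           + (E n.+2 - (2 - q) * E n.+1 + E n)) by rewrite /X; ring.
  rewrite !recE.
  transitivity (- ((m * (P n.+4 - 2 * P n.+3 + P n.+2) + d * (P n.+4 - P n.+2)
             + w * (P n.+4 + P n.+2))
    - 2 * (m * (P n.+3 - 2 * P n.+2 + P n.+1) + d * (P n.+3 - P n.+1)
             + w * (P n.+3 + P n.+1))
    + (m * (P n.+2 - 2 * P n.+1 + P n) + d * (P n.+2 - P n)
             + w * (P n.+2 + P n)))); first by ring.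
  by rewrite !recP; ring.
pose g := (m + d + w) * (2 - q) - 2 * m; pose h := - 2 * d.
pose r n := X n + (m + d + w) * f n.
have br : bounded_seq r := bounded_seqD bX (bounded_seqZ _ bf).
have E2 n : E n.+2 = (2 - q) * E n.+1 - E n - f n.
  by rewrite /f; have := recE n; lra.
have rE n : r n = g * E n.+1 + h * E n by rewrite /r /X /g /h E2; ring.
(* Strict damping excludes resonance: [h = - 2 d] is nonzero. *)
have N0 : 0 < g ^+ 2 + (2 - q) * g * h + h ^+ 2.
  have -> : g ^+ 2 + (2 - q) * g * h + h ^+ 2
    = (g + (1 - q / 2) * h) ^+ 2 + q * (1 - q / 4) * (4 * d ^+ 2).
    by rewrite /h; field.
  by rewrite ltr_wpDl ?sqr_ge0// !mulr_gt0 ?exprn_gt0//; lra.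
(* Cramer's rule: this combination of [r n], [r n.+1] and [f n] cancels [E n.+1] and leaves the
   quadratic form times [E n]. *)
have := bounded_seqZ (g ^+ 2 + (2 - q) * g * h + h ^+ 2)^-1
  (bounded_seqB (bounded_seqB (bounded_seqZ (g * (2 - q) + h) br)
    (bounded_seqZ g (bounded_seqS br))) (bounded_seqZ (g ^+ 2) bf)).
apply: bounded_seq_ext => n.
by rewrite !rE E2; field; rewrite (gt_eqF N0).
Qed.

Lemma lorentz_bounded (q d w k : R) (E P D : nat -> R) :
  0 < q -> q <= 2 -> 0 < d -> 0 < w -> 0 <= k ->
  (forall n, D n = E n + P n) ->
  (forall n, D n.+2 - 2 * D n.+1 + D n = - (q * E n.+1)) ->
  (forall n, P n.+2 - 2 * P n.+1 + P n + d * (P n.+2 - P n)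
             + w * (P n.+2 + P n) = k * (E n.+2 + E n)) ->
  bounded_seq E /\ bounded_seq P.
Proof.
move=> q0 q2 d0 w0 k0 DE recD recP.
have recE n : E n.+2 - (2 - q) * E n.+1 + E n = - (P n.+2 - 2 * P n.+1 + P n).
  by have := recD n; rewrite !DE; lra.
have decoupled m : 0 <= m ->
    (forall n, m * (P n.+2 - 2 * P n.+1 + P n) + d * (P n.+2 - P n)
             + w * (P n.+2 + P n) = 0) -> bounded_seq E /\ bounded_seq P.
  move=> m0 recPm; split; last by apply: damped_bounded recPm => //; exact: ltW.
  by apply: forced_leapfrog_bounded recPm recE => //; lra.
have [k00|kn0] := eqVneq k 0.
  by apply: (decoupled 1) => // n; have := recP n; rewrite k00 mul0r mul1r.
(* At [q = 2] the relation [recE] turns [E n.+2 + E n] into minus the second difference of [P], so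
   the coupling only raises the inertia to [1 + k]. *)
have [q22|qn2] := eqVneq q 2.
  apply: (decoupled (1 + k)) => [|n]; first lra.
  have := recP n; have := recE n; rewrite q22 subrr mul0r subr0 => ->.
  by lra.
have kp : 0 < k by rewrite lt_def kn0.
have q2p : q < 2 by rewrite lt_def eq_sym qn2.
pose W n := k * (2 * (D n.+1 - D n + q * (E n - E n.+1) / 2) ^+ 2
                 + q * (1 - q / 2) * (E n ^+ 2 + E n.+1 ^+ 2))
  + q * ((P n.+1 - P n) ^+ 2 + w * (P n.+1 ^+ 2 + P n ^+ 2)).
have Wdec n : W n.+1 <= W n.
  rewrite -subr_ge0.
  have -> : W n - W n.+1 = q * d * (P n.+2 - P n) ^+ 2.
    (* After this substitution the energy balance is a polynomial identity modulo [q (P n.+2 - P n)]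
       times the equation of [P]. *)
    have P2 : P n.+2 = 2 * P n.+1 - P n - E n.+2 + (2 - q) * E n.+1 - E n.
      by have := recE n; lra.
    have -> : W n - W n.+1 = q * d * (P n.+2 - P n) ^+ 2
      - q * (P n.+2 - P n) * (P n.+2 - 2 * P n.+1 + P n + d * (P n.+2 - P n)
          + w * (P n.+2 + P n) - k * (E n.+2 + E n)).
      by rewrite /W !DE P2; field.
    by rewrite recP subrr mulr0 subr0.
  by rewrite mulr_ge0 ?sqr_ge0// mulr_ge0 ?ltW.
have qp : 0 < q * (1 - q / 2) by rewrite mulr_gt0//; lra.
have nn (x : R) : 0 <= x ^+ 2 := sqr_ge0 x.
have qe := ltW qp; have we := ltW w0; have qq := ltW q0.
split.
- apply: (@bounded_seq_energy _ (k * (q * (1 - q / 2))) W) => // [|n].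
    by rewrite mulr_gt0.
  rewrite -subr_ge0 /W; set Y := (Y in 0 <= Y).
  have -> : Y = k * (2 * (D n.+1 - D n + q * (E n - E n.+1) / 2) ^+ 2
                 + q * (1 - q / 2) * E n.+1 ^+ 2)
  + q * ((P n.+1 - P n) ^+ 2 + w * (P n.+1 ^+ 2 + P n ^+ 2)) by rewrite /Y; ring.
  by do ?[exact: nn | assumption | apply: addr_ge0 | apply: mulr_ge0].
- apply: (@bounded_seq_energy _ (q * w) W) => // [|n].
    by rewrite mulr_gt0.
  rewrite -subr_ge0 /W; set Y := (Y in 0 <= Y).
  have -> : Y = k * (2 * (D n.+1 - D n + q * (E n - E n.+1) / 2) ^+ 2
                 + q * (1 - q / 2) * (E n ^+ 2 + E n.+1 ^+ 2))
  + q * ((P n.+1 - P n) ^+ 2 + w * P n.+1 ^+ 2) by rewrite /Y; ring.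
  by do ?[exact: nn | assumption | apply: addr_ge0 | apply: mulr_ge0].
Qed.

End real_recurrences.

(** * Complex sequences: the coefficients are real, so real and imaginary parts are treated
    separately *)

Lemma bounded_seq_realC {R : rcfType} {u : nat -> R} :
  bounded_seq u -> bounded_seq (fun n => (u n)%:C).
Proof.
move=> [M uM]; exists M%:C => n.
by rewrite normc_def /= expr0n addr0 sqrtr_sqr lecR.
Qed.

Lemma bounded_seq_complex {R : rcfType} {u : nat -> R[i]} :
  bounded_seq (fun n => complex.Re (u n)) ->
  bounded_seq (fun n => complex.Im (u n)) -> bounded_seq u.
Proof.
move=> /bounded_seq_realC bRe /bounded_seq_realC bIm.
apply: bounded_seq_ext (bounded_seqD bRe (bounded_seqZ 'i%C bIm)) => n.
by rewrite -complexE.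
Qed.

Lemma ReZ {R : rcfType} (a : R) (z : R[i]) :
  @complex.Re R (a%:C * z) = a * complex.Re z.
Proof. by case: z => x y /=; rewrite mul0r subr0. Qed.

Lemma ImZ {R : rcfType} (a : R) (z : R[i]) :
  @complex.Im R (a%:C * z) = a * complex.Im z.
Proof. by case: z => x y /=; rewrite mul0r addr0. Qed.

Section complex_recurrences.
Context {R : rcfType}.

Lemma damped_boundedC (d w : R) (P : nat -> R[i]) :
  0 <= d -> 0 < w ->
  (forall n, P n.+2 - 2 * P n.+1 + P n + d%:C * (P n.+2 - P n)
             + w%:C * (P n.+2 + P n) = 0) ->
  bounded_seq P.
Proof.
move=> d0 w0 recP; apply: bounded_seq_complex;
  apply: (damped_bounded 1 d w) => // n; rewrite mul1r.
- have := congr1 (@complex.Re R) (recP n).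
  by rewrite mulr_natl !(raddfD, raddfN, raddfMn) /= !(@ReZ R) ?(raddfD, raddfN) /=; lra.
- have := congr1 (@complex.Im R) (recP n).
  by rewrite mulr_natl !(raddfD, raddfN, raddfMn) /= !(@ImZ R) ?(raddfD, raddfN) /=; lra.
Qed.

Lemma lorentz_boundedC (q d w k : R) (E P D : nat -> R[i]) :
  0 < q -> q <= 2 -> 0 < d -> 0 < w -> 0 <= k ->
  (forall n, D n = E n + P n) ->
  (forall n, D n.+2 - 2 * D n.+1 + D n = - (q%:C * E n.+1)) ->
  (forall n, P n.+2 - 2 * P n.+1 + P n + d%:C * (P n.+2 - P n)
             + w%:C * (P n.+2 + P n) = k%:C * (E n.+2 + E n)) ->
  bounded_seq E /\ bounded_seq P.
Proof.
move=> q0 q2 d0 w0 k0 DE recD recP.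
have [|||ERe PRe] := @lorentz_bounded _ q d w k (fun n => complex.Re (E n))
    (fun n => complex.Re (P n)) (fun n => complex.Re (D n)) q0 q2 d0 w0 k0.
- by move=> n; rewrite DE raddfD.
- move=> n; have := congr1 (@complex.Re R) (recD n).
  by rewrite mulr_natl !(raddfD, raddfN, raddfMn) /= !(@ReZ R) ?(raddfD, raddfN) /=; lra.
- move=> n; have := congr1 (@complex.Re R) (recP n).
  by rewrite mulr_natl !(raddfD, raddfN, raddfMn) /= !(@ReZ R) ?(raddfD, raddfN) /=; lra.
have [|||EIm PIm] := @lorentz_bounded _ q d w k (fun n => complex.Im (E n))
    (fun n => complex.Im (P n)) (fun n => complex.Im (D n)) q0 q2 d0 w0 k0.
- by move=> n; rewrite DE raddfD.
- move=> n; have := congr1 (@complex.Im R) (recD n).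
  by rewrite mulr_natl !(raddfD, raddfN, raddfMn) /= !(@ImZ R) ?(raddfD, raddfN) /=; lra.
- move=> n; have := congr1 (@complex.Im R) (recP n).
  by rewrite mulr_natl !(raddfD, raddfN, raddfMn) /= !(@ImZ R) ?(raddfD, raddfN) /=; lra.
by split; apply: bounded_seq_complex.
Qed.

(* [f] and [g - s^* b] are the fields [E] and [D] one time step earlier than
   [e] and [g]. *)
Lemma state_bounded (s : R[i]) (q d w eps : R) (b e f g : nat -> R[i]) :
  let den := 1 + d%:C + w%:C * eps%:C in
  s * s^* = q%:C -> 0 <= q -> q <= 2 -> 0 < d -> 0 < w -> 1 <= eps ->
  (forall n, b n.+1 = b n - s * e n) ->
  (forall n, e n.+1 = 2 * d%:C * s^* / den * b n
     + (2 - q%:C * (1 + d%:C + w%:C)) / den * e n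
     - (1 - d%:C + w%:C * eps%:C) / den * f n + 2 * w%:C / den * g n) ->
  (forall n, f n.+1 = e n) ->
  (forall n, g n.+1 = s^* * b n - q%:C * e n + g n) ->
  [/\ bounded_seq b, bounded_seq e, bounded_seq f & bounded_seq g].
Proof.
move=> den sq q0 q2 d0 w0 eps1 recb rece recf recg.
have eps0 : 0 < eps by exact: lt_le_trans eps1.
have den0 : den != 0.
  rewrite /den -rmorphM -(rmorph1 (real_complex R)) -!rmorphD /= fmorph_eq0.
  by rewrite gt_eqF// !addr_gt0// mulr_gt0.
rewrite {}/den in den0 rece.
suff [bf bb bg] : [/\ bounded_seq f, bounded_seq b & bounded_seq g].
  by split=> //; apply: bounded_seq_ext (bounded_seqS bf) => n; rewrite recf.
have [q00|qn0] := eqVneq q 0.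
  have s0 : s = 0 by apply/eqP; rewrite -mul_conjC_eq0 sq q00.
  have bE n : b n = b 0%N by elim: n => // n; rewrite recb s0 mul0r subr0.
  have gE n : g n = g 0%N.
    by elim: n => // n; rewrite recg s0 q00 conjC0 !mul0r subr0 add0r.
  split.
  - have eps0C : eps%:C != 0 by rewrite fmorph_eq0 gt_eqF.
    (* With [g] constant and [s = 0], the value [g 0 / eps] is the equilibrium of [f]; the deviation
       from it oscillates with stiffness [w * eps]. *)
    have bF : bounded_seq (fun n => f n - g 0%N / eps%:C).
      apply: (@damped_boundedC d (w * eps)) => [||n]; first exact: ltW.
        exact: mulr_gt0.
      rewrite rmorphM /= !recf rece s0 q00 gE conjC0 rmorph0.
      by field; rewrite eps0C den0.
    apply: bounded_seq_ext (bounded_seqD bF (bounded_seq_cst (g 0%N / eps%:C))) => n.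
    exact: subrK.
  - by apply: bounded_seq_ext (bounded_seq_cst (b 0%N)) => n; rewrite bE.
  - by apply: bounded_seq_ext (bounded_seq_cst (g 0%N)) => n; rewrite gE.
pose D n := g n - s^* * b n.
have DS n : D n.+1 = g n by rewrite /D recg recb mulrBr -sq; ring.
have [|||||bf bP] := @lorentz_boundedC q d w (w * (eps - 1)) f
    (fun n => D n - f n) D _ q2 d0 w0.
- by rewrite lt_def qn0.
- by rewrite mulr_ge0 ?subr_ge0// ltW.
- by move=> n; rewrite addrC subrK.
- by move=> n; rewrite !DS recg recf /D; ring.
- move=> n; rewrite !DS !recf rmorphM rmorphB rmorph1 /= recg rece /D.
  by field.
have bD : bounded_seq D.
  by apply: bounded_seq_ext (bounded_seqD bP bf) => n; rewrite subrK.
have bg : bounded_seq g.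
  by apply: bounded_seq_ext (bounded_seqS bD) => n; rewrite DS.
split=> //.
(* The field [b] is recovered from [g n - D n = s^* b n], which requires [q] nonzero. *)
have s0 : s^* != 0.
  by rewrite conjC_eq0 -mul_conjC_eq0 sq fmorph_eq0.
apply: bounded_seq_ext (bounded_seqZ (s^*)^-1 (bounded_seqB bg bD)) => n.
by rewrite /D; field.
Qed.

End complex_recurrences.

(** * From entries to matrix powers, and the CFL bound *)

Lemma bounded_seq_mx (K : numFieldType) (m n : nat) (A : nat -> 'M[K]_(m, n)) :
  (forall i j, bounded_seq (fun k => A k i j)) -> bounded_fun A.
Proof.
move=> bA; apply/ex_bound; first exact: (@globally_properfilter _ _ 0%N).
have [M AM] : exists M : 'I_m -> 'I_n -> K, forall i j k, `|A k i j| <= M i j.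
  have [M AM] := choice (fun ij => bA ij.1 ij.2).
  by exists (fun i j => M (i, j)) => i j; exact: AM (i, j).
have M0 i j : 0 <= M i j by exact: le_trans (AM i j 0%N).
exists (\sum_ij M ij.1 ij.2) => k _ /=.
(* The maximum norm is known to be attained at an entry only when it is nonzero. *)
have [/mx_norm_eq0 A0|/mx_norm_neq0 [[i j] Aij]] := eqVneq (mx_norm (A k)) 0.
  by rewrite A0 normr0 sumr_ge0.
rewrite [leLHS]Aij /= (le_trans (AM i j k))// (bigD1 (i, j))//= lerDl.
by rewrite sumr_ge0.
Qed.

Lemma sum_ord4 (V : nmodType) (F : 'I_4 -> V) :
  \sum_i F i = F (@Ordinal 4 0 isT) + F (@Ordinal 4 1 isT)
             + F (@Ordinal 4 2 isT) + F (@Ordinal 4 3 isT).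
Proof.
rewrite !big_ord_recl big_ord0 addr0 !addrA.
by do !congr (_ + _); congr F; apply: val_inj.
Qed.

Lemma normC_expi_sub1 (R : realType) (t : R) :
  `|expi t - 1| ^+ 2 = (2 * (1 - cos t))%:C.
Proof.
rewrite normCK; apply/eqP; rewrite eq_complex /=; apply/andP; split; apply/eqP.
  have := cos2Dsin2 t; rewrite !expr2; lra.
ring.
Qed.

(** The CFL condition amounts to [lambda <= 1 / sqrt 2]; the square gives [q <= 4 lambda^2 <= 2],
    the range where the energy is nonnegative. *)
Lemma lambda_sq_le (R : realType) (p : ml_params R) :
  0 < eps0 p -> 0 < mu0 p -> 0 < epsinf p -> 0 < dt p -> 0 < dx p ->
  dt p <= dx p / (Num.sqrt 2 * cinf p) -> lambda p ^+ 2 <= 2^-1.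
Proof.
move=> e0 m0 ei0 t0 x0 cfl.
have c0 : 0 < cinf p by rewrite /cinf div1r invr_gt0 sqrtr_gt0 !mulr_gt0.
have s0 : 0 < Num.sqrt 2 :> R by rewrite sqrtr_gt0.
have l0 : 0 <= lambda p by rewrite /lambda !mulr_ge0 ?invr_ge0// ltW.
have : lambda p <= (Num.sqrt 2)^-1.
  rewrite /lambda ler_pdivrMr//.
  rewrite ler_pdivlMr in cfl; last exact: mulr_gt0.
  rewrite [leRHS]mulrC ler_pdivlMr//; apply: le_trans cfl.
  by rewrite le_eqVlt; apply/orP; left; apply/eqP; ring.
move=> l1; have -> : 2^-1 = (Num.sqrt 2)^-1 ^+ 2 :> R by rewrite exprVn sqr_sqrtr.
by rewrite lerXn2r// nnegrE ?invr_ge0 ?ltW.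
Qed.

Theorem mainTheorem3 (R : realType) (p : ml_params R)
    (eps0_gt0 : 0 < eps0 p) (mu0_gt0 : 0 < mu0 p) (epsinf_gt0 : 0 < epsinf p)
    (omega1_gt0 : 0 < omega1 p) (dt_gt0 : 0 < dt p) (dx_gt0 : 0 < dx p)
    (epsinf_le_epss : epsinf p <= epss p) (nu_gt0 : 0 < nu p)
    (cfl : dt p <= dx p / (Num.sqrt 2 * cinf p)) :
  von_neumann_stable (amplification p).
Proof.
move=> xi; apply: bounded_seq_mx => i j.
pose q := lambda p ^+ 2 * (2 * (1 - cos xi)).
have qE : qsym p xi = q%:C.
  rewrite /qsym /sigma normrM exprMn normC_expi_sub1 /q [RHS]rmorphM /=.
  congr (_ * _); rewrite normc_def /= expr0n addr0 sqrtr_sqr -rmorphXn /=.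
  by rewrite real_normK ?num_real.
have cos1 : 0 <= 1 - cos xi by rewrite subr_ge0 cos_le1.
have q0 : 0 <= q by rewrite mulr_ge0 ?sqr_ge0// mulr_ge0.
have q2 : q <= 2.
  have l2 := lambda_sq_le _ _ eps0_gt0 mu0_gt0 epsinf_gt0 dt_gt0 dx_gt0 cfl.
  have := cos_geN1 xi; have := sqr_ge0 (lambda p).
  rewrite /q; nra.
(* Column [j] of the powers is the orbit of the [j]-th basis vector under [G], so its four rows are
   the state sequences of [state_bounded]. *)
pose u k n := (amplification p xi ^+ n) (inord k) j.
pose a k l := amplification p xi (inord k) (inord l).
have uS k n : u k n.+1 = a k 0%N * u 0%N n + a k 1%N * u 1%N n
    + a k 2%N * u 2%N n + a k 3%N * u 3%N n.
  rewrite /u exprS mxE sum_ord4 /a.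
  by do !congr (_ + _); congr (_ * _); congr (_ _ _); apply: val_inj; rewrite /= inordK.
have [b0 b1 b2 b3] : [/\ bounded_seq (u 0%N), bounded_seq (u 1%N),
    bounded_seq (u 2%N) & bounded_seq (u 3%N)].
  apply: (@state_bounded _ (sigma p xi) q (delta p) (omega p) (epss' p)) => //.
  - by rewrite -qE /qsym normCK.
  - by rewrite /delta !mulr_gt0.
  - by rewrite /omega !mulr_gt0 ?exprn_gt0.
  - by rewrite /epss' ler_pdivlMr// mul1r.
  - by move=> n; rewrite uS /a !mxE !inordK//=; ring.
  - by move=> n; rewrite uS /a !mxE !inordK//= qE; ring.
  - by move=> n; rewrite uS /a !mxE !inordK//=; ring.
  - by move=> n; rewrite uS /a !mxE !inordK//= qE; ring.
have -> : (fun n => (amplification p xi ^+ n) i j) = u i.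
  by apply/funext => n; rewrite /u inord_val.
by case: i => -[|[|[|[|//]]]] lti.
Qed.
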